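(* For every $\theta\in\mathbb{R}$, $\displaystyle\lim_{n\to\infty}\hat\theta_n=\theta$ holds $P$-almost surely.
   Context: Fix $m>1/2$. Let $c_m:=\left(\int_{\mathbb R}(1+x^2)^{-m}\,dx\right)^{-1}$ and $f(x):=c_m(1+x^2)^{-m}$. For $\theta\in\mathbb R$, $\mathrm{PVII}_m(\theta,1)$ denotes the Pearson Type VII distribution with location $\theta$ and scale $1$, i.e. the law with density $x\mapsto f(x-\theta)$ (for $m=1$ this is the Cauchy distribution). Let $(X_n)_{n\ge1}$ be i.i.d. random variables on a probability space $(\Omega,\mathcal F,P)$ with law $\mathrm{PVII}_m(\theta,1)$. For each $n$, let $\hat\theta_n(x_1,\dots,x_n)$ be any Borel measurable function on $\mathbb R^n$ such that $\hat\theta_n(x_1,\dots,x_n)$ is a maximizer of $t\mapsto\prod_{i=1}^n f(x_i-t)$ over $t\in\mathbb R$ (such a measurable function exists), and let $\hat\theta_n:=\hat\theta_n(X_1,\dots,X_n)$ be the maximum likelihood estimator of the location. *)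

(* Defs.v *)
From HB Require Import structures.
From mathcomp Require Import all_boot all_order all_algebra.
From mathcomp Require Import all_classical all_reals all_analysis.
Set Implicit Arguments. Unset Strict Implicit. Unset Printing Implicit Defensive.
Import Order.TTheory GRing.Theory Num.Theory.
Import numFieldNormedType.Exports.
Local Open Scope classical_set_scope.
Local Open Scope ring_scope.

Definition pvii_const {R : realType} (m : R) : R :=
  (Rintegral (@lebesgue_measure R) setT (fun x : R => (1 + x ^+ 2) `^ (- m)))^-1.

Definition pvii_f {R : realType} (m : R) (x : R) : R :=
  pvii_const m * (1 + x ^+ 2) `^ (- m).

Definition has_pvii_law {d} {T : measurableType d} {R : realType}
  (P : probability T R) (m theta : R) (X : T -> R) : Prop :=
  forall A : set R, measurable A ->
    P (X @^-1` A) = (\int[@lebesgue_measure R]_(x in A) (pvii_f m (x - theta))%:E)%E.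

Definition mutually_independent {d} {T : measurableType d} {R : realType}
  (P : probability T R) (X : nat -> T -> R) : Prop :=
  forall (s : seq nat) (B : nat -> set R), uniq s ->
    (forall i, i \in s -> measurable (B i)) ->
    P (\bigcap_(i in [set j | j \in s]) (X i @^-1` B i)) =
    (\prod_(i <- s) P (X i @^-1` B i))%E.

Definition pvii_likelihood {R : realType} (m : R) n (x : n.-tuple R) (t : R) : R :=
  \prod_(i < n) pvii_f m (tnth x i - t).

(* Main.v *)
(** With [r_t(x) = (1 + (x - theta)^2) / (1 + (x - t)^2)], comparing the
    likelihoods at [theta] and at the estimator [t] gives
    [\prod_i r_t(X_i) >= 1].  If [r_t^s <= G] for all [t] in a set [U], with
    [s > 0] and [E G(X) < 1], then by Markov's inequality and independence the
    estimator lies in [U] at time [n] with probability at most [(E G(X))^n],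
    so by Borel-Cantelli it almost surely leaves [U] for good.
    - Near [t <> theta]: [r_u <= (1 + e + e^2) r_t] for [|u - t| <= e], and with
      [s = m / 2] the mean of [r_t^s] is a Hellinger affinity, hence below [1].
    - Near infinity: [r_t(x) <= 2 (1 + (x - theta)^2)^2 / (1 + (t - theta)^2)],
      and [1 + (X - theta)^2] has a moment of positive order since [m > 1/2].
    Compactness of a segment combines the two. *)
Require Import Defs.
From HB Require Import structures.
From mathcomp Require Import all_boot all_order all_algebra.
From mathcomp Require Import all_classical all_reals all_analysis.
From mathcomp Require Import measurable_realfun ring lra.
Set Implicit Arguments. Unset Strict Implicit. Unset Printing Implicit Defensive.
Import Order.TTheory GRing.Theory Num.Theory.
Import numFieldNormedType.Exports.
Local Open Scope classical_set_scope.
Local Open Scope ring_scope.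

(** * Reducing weighted integrals to indicators *)

Section transfer.
Local Open Scope ereal_scope.
Import HBNNSimple.

(** Monotone convergence along the simple functions approximating [h] from below. The limit depends
    on [mu], [X] and [W] only through weighted integrals of indicators. *)
Lemma ge0_integral_comp_lim (d d' : measure_display) (T : measurableType d)
    (S : measurableType d') (R : realType) (mu : {measure set T -> \bar R})
    (X : T -> S) (W : T -> R) (h : S -> R)
    (mX : measurable_fun setT X) (mW : measurable_fun setT W)
    (mh : measurable_fun setT (fun y => (h y)%:E : \bar R)) :
  (forall x, 0 <= W x)%R -> (forall y, 0 <= h y)%R ->
  \int[mu]_x (W x * h (X x))%:E =
  limn (fun n => \sum_(k \in range (nnsfun_approx measurableT mh n))
    k%:E * \int[mu]_x
      (W x * \1_(nnsfun_approx measurableT mh n @^-1` [set k]) (X x))%:E).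
Proof.
move=> W0 h0; set g := nnsfun_approx measurableT mh.
have mgX n : measurable_fun setT (g n \o X) by exact: measurableT_comp.
transitivity (limn (fun n => \int[mu]_x (W x * g n (X x))%:E)).
  rewrite -monotone_convergence//.
  - apply: eq_integral => x _; apply/esym/cvg_lim => //.
    under eq_fun do rewrite EFinM.
    rewrite EFinM; apply: cvgeZl => //.
    by apply: (cvg_nnsfun_approx measurableT mh) => // y _; rewrite lee_fin.
  - by move=> n; apply/measurable_EFinP; apply: measurable_funM; last exact: mgX.
  - by move=> n x _; rewrite lee_fin mulr_ge0.
  - move=> x _ m n mn; rewrite lee_fin ler_wpM2l//.
    exact/lefP/nd_nnsfun_approx.
congr (limn _); apply/funext => n.
have mB k : measurable_fun setT (fun x => \1_(g n @^-1` [set k]) (X x) : R).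
  exact: (measurableT_comp (measurable_indic _)).
transitivity (\int[mu]_x \sum_(k \in range (g n))
    (k * (W x * \1_(g n @^-1` [set k]) (X x)))%:E).
  apply: eq_integral => x _; rewrite fsumEFin//; congr EFin.
  rewrite [in LHS](fimfunE (g n)) mulrC !fsbig_finite//= mulr_suml.
  by apply: eq_bigr => k _; rewrite -mulrA [(_ * W x)%R]mulrC.
have mWB k : measurable_fun setT (fun x => W x * \1_(g n @^-1` [set k]) (X x))%R.
  exact: measurable_funM.
rewrite ge0_integral_fsum//.
- apply: eq_fsbigr => k /[!inE] -[y _ <-].
  under eq_integral do rewrite EFinM.
  rewrite ge0_integralZl_EFin//.
  + by move=> x _; rewrite lee_fin mulr_ge0.
  + exact/measurable_EFinP.
- by move=> k; exact/measurable_EFinP/measurable_funM.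
- move=> k x _; rewrite lee_fin mulrCA mulr_ge0//.
  exact: nnfun_muleindic_ge0.
Qed.

(** The weights let one statement serve twice: to pass from a law to its density, and to split off
    one factor of a product of independent variables. *)
Lemma ge0_integral_transfer (d1 d2 d' : measure_display)
    (T1 : measurableType d1) (T2 : measurableType d2) (S : measurableType d')
    (R : realType)
    (mu1 : {measure set T1 -> \bar R}) (mu2 : {measure set T2 -> \bar R})
    (X1 : T1 -> S) (X2 : T2 -> S) (W1 : T1 -> R) (W2 : T2 -> R) (h : S -> R) :
  measurable_fun setT X1 -> measurable_fun setT X2 ->
  measurable_fun setT W1 -> measurable_fun setT W2 ->
  (forall x, 0 <= W1 x)%R -> (forall x, 0 <= W2 x)%R ->
  (forall A, measurable A -> \int[mu1]_x (W1 x * \1_A (X1 x))%:E =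
                             \int[mu2]_x (W2 x * \1_A (X2 x))%:E) ->
  measurable_fun setT h -> (forall y, 0 <= h y)%R ->
  \int[mu1]_x (W1 x * h (X1 x))%:E = \int[mu2]_x (W2 x * h (X2 x))%:E.
Proof.
move=> mX1 mX2 mW1 mW2 W10 W20 W12 mh h0.
have mEh : measurable_fun setT (fun y => (h y)%:E : \bar R) by exact/measurable_EFinP.
rewrite (ge0_integral_comp_lim mu1 mX1 mW1 mEh)//.
rewrite (ge0_integral_comp_lim mu2 mX2 mW2 mEh)//.
congr (limn _); apply/funext => n; apply: eq_fsbigr => k _.
by rewrite W12.
Qed.

End transfer.

(** * Means of products over an i.i.d. sequence *)

Section iid.
Context (R : realType) (d : measure_display) (T : measurableType d)
  (P : probability T R) (X : nat -> {RV P >-> R}).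
Hypothesis indep : mutually_independent P (fun n => (X n : T -> R)).
Hypothesis ident : forall n (A : set R), measurable A ->
  P (X n @^-1` A) = P (X 0%N @^-1` A).
Local Open Scope ereal_scope.

Let measurable_bigcap_seq (s : seq nat) (B : nat -> set R) :
  (forall i, i \in s -> measurable (B i)) ->
  measurable (\bigcap_(i in [set j | j \in s]) (X i @^-1` B i)).
Proof.
move=> mB; apply: bigcap_measurableType => i /= /mB mBi.
by rewrite -[X in measurable X]setTI; exact: (measurable_funP (X i)).
Qed.

Lemma measurable_prod_comp (G : R -> R) (k : nat) : measurable_fun setT G ->
  measurable_fun setT (fun w => \prod_(i < k) G (X i w))%R.
Proof.
move=> mG; apply: measurable_prod => i _; exact: measurableT_comp.
Qed.

(** Independence is given for events only, so the induction on [k] carries along events at indices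
    at least [k]. In the inductive step [G (X k)] is traded for the indicator of an event on [X k],
    which joins those events. *)
Lemma integral_prod_indic_iid (G : R -> R) (e : R) :
  measurable_fun setT G -> (forall y, 0 <= G y)%R ->
  \int[P]_w (G (X 0%N w))%:E = e%:E ->
  forall (k : nat) (s : seq nat) (B : nat -> set R), uniq s ->
    (forall i, i \in s -> (k <= i)%N) ->
    (forall i, i \in s -> measurable (B i)) ->
  \int[P]_w (\prod_(i < k) G (X i w) *
    \1_(\bigcap_(i in [set j | j \in s]) (X i @^-1` B i)) w)%:E =
  (e ^+ k)%:E * \prod_(i <- s) P (X i @^-1` B i).
Proof.
move=> mG G0 Ge; have e0 : (0 <= e)%R.
  by rewrite -lee_fin -Ge; apply: integral_ge0 => w _; rewrite lee_fin.
elim=> [|k IH] s B us sk mB.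
  under eq_integral do rewrite big_ord0 mul1r.
  rewrite integral_indic ?setIT ?expr0 ?mul1e//; last exact: measurable_bigcap_seq.
  exact: indep.
set C := \bigcap_(i in _) _.
have mC : measurable C by exact: measurable_bigcap_seq.
(* By independence the product is the probability of an intersection, hence finite; it can then
   enter a real-valued weight. *)
have [pfin p0] : \prod_(i <- s) P (X i @^-1` B i) \is a fin_num /\
    0 <= \prod_(i <- s) P (X i @^-1` B i).
  by rewrite -indep// fin_num_measure.
set p := \prod_(i <- s) _ in pfin p0 *.
have {}p0 : (0 <= fine p)%R by rewrite fine_ge0.
have kNs : k \notin s by apply/negP => /sk; rewrite ltnn.
under eq_integral do rewrite big_ord_recr/= mulrAC.
(* The other factors and the indicator of [C] act as a weight for [X k]; it integrates like a
   constant weight for [X 0]. *)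
rewrite (@ge0_integral_transfer _ _ _ _ _ _ _ _ P (X k) (X 0%N) _
  (cst (e ^+ k * fine p)%R))//.
- under eq_integral do rewrite EFinM.
  rewrite ge0_integralZl_EFin//.
  + by rewrite Ge -!EFinM -[p]fineK// -EFinM exprSr; congr EFin; ring.
  + by move=> w _; rewrite lee_fin.
  + by apply/measurable_EFinP; exact: measurableT_comp.
  + by rewrite mulr_ge0// exprn_ge0.
- by apply: measurable_funM => //; exact: measurable_prod_comp.
- by move=> w; rewrite mulr_ge0//; apply: prodr_ge0.
- by move=> w; rewrite mulr_ge0// exprn_ge0.
- move=> A mA.
  (* As [k] is not in [s], setting the event at [k] to [A] leaves those indexed by [s] unchanged. *)
  pose B' i := if i == k then A else B i.
  have eqB i : i \in s -> B' i = B i.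
    by rewrite /B'; case: eqP => // -> /(negP kNs).
  transitivity (\int[P]_w (\prod_(i < k) G (X i w) *
      \1_(\bigcap_(i in [set j | j \in k :: s]) (X i @^-1` B' i)) w)%:E).
    apply: eq_integral => w _; rewrite -mulrA; congr (_ * _)%:E.
    rewrite !indicE -natrM mulnb; congr ((nat_of_bool _)%:R).
    apply/andP/idP; rewrite !inE.
      move=> [Cw Aw] i /=; rewrite inE => /orP[/eqP->|si].
        by rewrite /B' eqxx.
      by rewrite eqB//; exact: Cw.
    move=> h; split.
      by move=> i /= si; rewrite -eqB//; apply: h => /=; rewrite inE si orbT.
    have := h k; rewrite /= /B' eqxx; apply.
    by rewrite inE eqxx.
  rewrite IH//=.
  + rewrite big_cons {1}/B' eqxx ident//.
    have -> : \prod_(j <- s) P (X j @^-1` B' j) = p.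
      by rewrite /p !big_seq; apply: eq_bigr => i /eqB ->.
    under eq_integral do rewrite EFinM.
    rewrite ge0_integralZl_EFin//.
    * rewrite (_ : (fun w => (\1_A (X 0%N w))%:E) =
        (fun w => (\1_(X 0%N @^-1` A) w)%:E))//.
      rewrite integral_indic ?setIT//; last first.
        by rewrite -[X in measurable X]setTI; exact: (measurable_funP (X 0%N)).
      by rewrite EFinM fineK// muleA muleAC.
    * by apply/measurable_EFinP; exact: measurableT_comp.
    * by rewrite mulr_ge0// exprn_ge0.
  + by rewrite kNs.
  + by move=> i; rewrite inE => /orP[/eqP->//|/sk/ltnW].
  + move=> i; rewrite inE => /orP[/eqP->|si]; first by rewrite /B' eqxx.
    by rewrite eqB//; exact: mB.
Qed.

Lemma integral_prod_iid (G : R -> R) (e : R) (k : nat) :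
  measurable_fun setT G -> (forall y, 0 <= G y)%R ->
  \int[P]_w (G (X 0%N w))%:E = e%:E ->
  \int[P]_w (\prod_(i < k) G (X i w))%:E = (e ^+ k)%:E.
Proof.
move=> mG G0 Ge; have := @integral_prod_indic_iid G e mG G0 Ge k [::] (fun=> setT).
rewrite big_nil mule1 => <-//; apply: eq_integral => w _.
by rewrite indicE mem_set ?mulr1//.
Qed.

(* Markov's inequality bounds the probability of the complement at time [n]
   by the [n]-th power of the mean. *)
Lemma ae_near_prod_lt1 (G : R -> R) :
  measurable_fun setT G -> (forall y, 0 <= G y)%R ->
  \int[P]_w (G (X 0%N w))%:E < 1 ->
  {ae P, forall w, \forall n \near \oo, (\prod_(i < n) G (X i w) < 1)%R}.
Proof.
move=> mG G0 G1; set I := integral _ _ _ in G1.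
have I0 : 0 <= I by apply: integral_ge0 => w _; rewrite lee_fin.
have Ifin : I \is a fin_num by rewrite ge0_fin_numE// (lt_trans G1)// ltry.
pose e := fine I; have Ge : I = e%:E by rewrite fineK.
have e0 : (0 <= e)%R by rewrite fine_ge0.
have e1 : (e < 1)%R by rewrite -lte_fin -Ge.
pose F n := [set w | (1 <= \prod_(i < n) G (X i w))%R].
have mF n : measurable (F n).
  rewrite -[F n]setTI; apply: measurable_fun_le => //.
  exact: measurable_prod_comp.
have PF n : P (F n) <= (e ^+ n)%:E.
  rewrite -(integral_prod_iid n mG G0 Ge).
  have mp : measurable_fun setT (EFin \o (fun w => \prod_(i < n) G (X i w))%R).
    by apply/measurable_EFinP; exact: measurable_prod_comp.
  have := @le_integral_abse _ _ _ P _ measurableT _ 1%R mp ltr01.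
  rewrite mul1e setTI.
  have p0 w : (0 <= \prod_(i < n) G (X i w))%R by exact: prodr_ge0.
  rewrite (_ : [set x | _] = F n); last first.
    by apply/seteqP; split => w /=; rewrite lee_fin ger0_norm.
  rewrite (eq_integral (fun w => (\prod_(i < n) G (X i w))%:E))// => w _.
  by rewrite /= ger0_norm.
(* Borel-Cantelli: the probabilities are dominated by a geometric series of ratio [e < 1]. *)
have : P (lim_sup_set F) = 0.
  apply: lim_sup_set_cvg0 => //.
  apply: (@le_lt_trans _ _ (\sum_(n <oo) (e ^+ n)%:E)).
    by apply: lee_nneseries => [n _ _|n _]; [exact: measure_ge0|exact: PF].
  have : EFin \o series (geometric 1%R e) @ \oo --> (1 / (1 - e))%:E.
    apply: cvg_EFin; first exact: nearW.
    by apply: cvg_geometric_series; rewrite ger0_norm.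
  rewrite (_ : EFin \o _ = (fun n => \sum_(0 <= i < n) (e ^+ i)%:E)).
    by move=> /cvg_lim ->//; rewrite ltry.
  apply/funext => n /=; rewrite /series/= -sumEFin; apply: eq_bigr => i _.
  by rewrite mul1r.
move=> PF0; exists (lim_sup_set F); split => //.
  by apply: bigcap_measurableType => n _; apply: bigcup_measurable.
move=> w /= nw n _; apply: contrapT => Fn; apply: nw.
exists n => // k /= nk; rewrite ltNge; apply/negP => Fk; apply: Fn.
by exists k.
Qed.

End iid.

(** * Translation invariance and integrability of powers *)

Section lebesgue.
Context {R : realType}.
Local Notation mu := (@lebesgue_measure R).

(** Translation preserves the length of the intervals []a, b]], and these lengths determine Lebesgue
    measure. *)
Lemma lebesgue_measureB (t : R) (A : set R) : measurable A ->
  pushforward mu ((fun x => x - t)%R : _ -> measurableTypeR R) A = mu A.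
Proof.
move=> mA; apply/esym/lebesgue_measure_unique => //=.
  exact: measurable_funB.
move=> _ _ [[a b]] _ <-.
rewrite /pushforward/= (_ : _ @^-1` _ = `]a + t, b + t]%classic).
  rewrite !lebesgue_measure_itv/= !lte_fin ltrD2r; case: ifP => // _.
  by rewrite -!EFinB; congr EFin; ring.
by apply/seteqP; split => x /=; rewrite !in_itv/= ltrBrDr lerBlDr.
Qed.

Lemma ge0_integral_shift (t : R) (f : R -> \bar R) :
  measurable_fun setT f -> (forall x, 0 <= f x)%E ->
  (\int[mu]_x f (x - t)%R = \int[mu]_x f x)%E.
Proof.
move=> mf f0.
transitivity (\int[pushforward mu ((fun x => x - t)%R : _ -> measurableTypeR R)]_x f x)%E.
  by rewrite ge0_integral_pushforward//; exact: measurable_funB.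
apply: eq_measure_integral => //=; first exact: measurable_funB.
by move=> _ A mA _; exact: lebesgue_measureB.
Qed.

Lemma continuous_powR_1Dsqr (p t : R) :
  continuous (fun x : R => (1 + (x - t) ^+ 2) `^ p).
Proof.
move=> x; apply: (@continuous_comp _ _ _ (fun x : R => 1 + (x - t) ^+ 2)
  (@powR R ^~ p)).
  apply: cvgD; first exact: cvg_cst.
  have xt : (y - t) @[y --> x] --> x - t by apply: cvgB => //; exact: cvg_cst.
  exact: (cvgM xt xt).
apply: differentiable_continuous; apply/derivable1_diffP.
apply: derivable_powR; rewrite in_itv/= andbT.
by rewrite ltr_pwDl// sqr_ge0.
Qed.

Lemma cvg_powR_1D_pinfty (q : R) : 0 < q -> (1 + x) `^ (- q) @[x --> +oo] --> 0.
Proof.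
move=> q0; apply/cvgr0Pnorm_le => e e0; near=> x.
(* The threshold is the solution [y] of [y^(-q) = e]. *)
have ex : e `^ (- q^-1) <= 1 + x.
  rewrite -lerBlDl; near: x; apply: nbhs_pinfty_ge; exact: num_real.
rewrite ger0_norm ?powR_ge0//.
have -> : e = (e `^ (- q^-1)) `^ (- q).
  by rewrite -powRrM mulrNN mulVf ?gt_eqF// powRr1// ltW.
have ep : 0 < e `^ (- q^-1) by rewrite powR_gt0.
rewrite !(powRN _ q) lef_pV2 ?posrE ?powR_gt0//; last exact: lt_le_trans ex.
by rewrite ge0_ler_powR// ?nnegrE// ltW//; exact: lt_le_trans ex.
Unshelve. all: by end_near. Qed.

Lemma integral_powR_1D_lty (q : R) : 1 < q ->
  (\int[mu]_(x in `[0%R, +oo[) ((1 + x) `^ (- q))%:E < +oo)%E.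
Proof.
(* An antiderivative of the integrand that tends to 0 at infinity because [1 < q]. It is
   differentiated on all of [x > -1], so that the endpoint 0 is an interior point. *)
move=> q1; pose F (x : R) := (1 - q)^-1 * (1 + x) `^ (1 - q).
have d1 (x : R) : -1 < x -> is_derive x 1 F ((1 + x) `^ (- q)).
  move=> x1; have x10 : 0 < 1 + x by rewrite -ltrBlDl sub0r.
  have h : is_derive x (1 : R) (fun y : R => 1 + y) 1.
    have := is_deriveD (is_derive_cst (1 : R) x (1 : R)) (is_derive_id x (1 : R)).
    by rewrite add0r.
  have h2 := @is_derive1_powR R (1 - q) (1 + x) x10.
  have h3 := @is_derive1_comp R (@powR R ^~ (1 - q)) (fun y => 1 + y) x _ _ h2 h.
  have := is_deriveZ (1 - q)^-1 h3.
  rewrite /GRing.scale/= mulr1 mulrA mulVf ?mul1r; last first.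
    by rewrite subr_eq0 lt_eqF.
  by rewrite (_ : 1 - q - 1 = - q)//; ring.
have cpow (x : R) : -1 < x -> (fun y : R => (1 + y) `^ (- q)) @ x --> (1 + x) `^ (- q).
  move=> x1; apply: (@continuous_comp _ _ _ (fun y : R => 1 + y) (@powR R ^~ (- q))).
    by apply: cvgD => //; exact: cvg_cst.
  apply: differentiable_continuous; apply/derivable1_diffP.
  by apply: derivable_powR; rewrite in_itv/= andbT -ltrBlDl sub0r.
rewrite (@ge0_continuous_FTC2y _ _ F 0 0).
- by rewrite -EFinB ltry.
- by move=> x _; exact: powR_ge0.
- apply/continuous_within_itvcyP; split.
    move=> x; rewrite in_itv/= andbT => x0.
    exact/cpow/(lt_trans (ltrN10 _) x0).
  by apply: cvg_at_right_filter; exact/cpow/ltrN10.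
- rewrite -[X in _ --> X](mulr0 (1 - q)^-1); apply: cvgM; first exact: cvg_cst.
  rewrite -(opprB q 1); apply: cvg_powR_1D_pinfty; rewrite subr_gt0//.
- move=> x x0; have := d1 x (lt_trans (ltrN10 _) x0).
  by move=> /@ex_derive.
- apply: cvg_at_right_filter; apply: differentiable_continuous.
  by apply/derivable1_diffP; have := d1 0 (ltrN10 _) => /@ex_derive.
- move=> x; rewrite in_itv/= andbT => x0.
  by rewrite derive1E; have := d1 x (lt_trans (ltrN10 _) x0) => /@derive_val.
Qed.

(** By symmetry it suffices to integrate over [x >= 0], where [(1 + x)^2 <= 2 (1 + x^2)] bounds the
    integrand by [2^p (1 + x)^(-2p)], with [2p > 1]. *)
Lemma integral_powR_1Dsqr_lty (p : R) : 1 / 2 < p ->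
  (\int[mu]_x ((1 + x ^+ 2) `^ (- p))%:E < +oo)%E.
Proof.
move=> p12.
have cf : continuous (fun x : R => (1 + x ^+ 2) `^ (- p)).
  rewrite (_ : (fun x => _) = fun x => (1 + (x - 0) ^+ 2) `^ (- p)).
    exact: continuous_powR_1Dsqr.
  by apply/funext => x; rewrite subr0.
have mg : measurable_fun setT (fun x : R => (1 + x) `^ (- (2 * p))).
  by apply: (measurableT_comp (measurable_powR _)); exact: measurable_funD.
rewrite ge0_symfun_integralT//; first last.
- by move=> x /=; rewrite sqrrN.
- by move=> x; exact: powR_ge0.
rewrite -set_itvcy; apply: lte_mul_pinfty => //.
apply: (@le_lt_trans _ _
  (\int[mu]_(x in `[0%R, +oo[) ((2 `^ p)%:E * ((1 + x) `^ (- (2 * p)))%:E))%E).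
  apply: ge0_le_integral => //.
  - by move=> x _; rewrite lee_fin powR_ge0.
  - by apply/measurable_EFinP/measurable_funTS; exact: continuous_measurable_fun.
  - apply/measurable_EFinP/measurable_funM => //; exact: measurable_funTS.
  - move=> x /=; rewrite in_itv/= andbT => x0.
    have x1 : 0 < 1 + x by rewrite ltr_pwDl.
    have x2 : 0 < 1 + x ^+ 2 by rewrite ltr_pwDl// sqr_ge0.
    rewrite -EFinM lee_fin !powRN powRrM (@powR_mulrn _ _ 2) ?(ltW x1)//.
    rewrite -[leLHS]mulr1 ler_pdivrMl ?powR_gt0// mulrCA mulrA.
    rewrite ler_pdivlMr ?powR_gt0 ?exprn_gt0// mul1r -powRM//; last exact: ltW.
    apply: ge0_ler_powR; rewrite ?nnegrE ?exprn_ge0 ?mulr_ge0//; try exact: ltW.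
      lra.
    have := sqr_ge0 (1 - x); lra.
rewrite ge0_integralZl_EFin//=.
- apply: lte_mul_pinfty; rewrite ?lee_fin ?powR_ge0//.
  by apply: integral_powR_1D_lty; lra.
- by move=> x _; rewrite lee_fin powR_ge0.
- exact/measurable_EFinP/measurable_funTS.
Qed.

End lebesgue.

(** * The Pearson VII density and its ratios *)

Section pvii.
Context {R : realType}.
Local Notation mu := (@lebesgue_measure R).

(** This is [r_t(x)]; its [m]-th power is the density ratio of location [t] to location [theta], the
    normalising constants cancelling. *)
Definition sqr_ratio (theta t x : R) : R :=
  (1 + (x - theta) ^+ 2) / (1 + (x - t) ^+ 2).

Lemma gt0_1Dsqr (x : R) : 0 < 1 + x ^+ 2.
Proof. by rewrite ltr_pwDl// sqr_ge0. Qed.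

Lemma sqr_ratio_gt0 (theta t x : R) : 0 < sqr_ratio theta t x.
Proof. by rewrite divr_gt0// gt0_1Dsqr. Qed.

(** After clearing the denominator the squares of [x] cancel, leaving a linear equation with leading
    coefficient [2 (t - theta)]. *)
Lemma sqr_ratio_eq1 (theta t x : R) : theta != t ->
  sqr_ratio theta t x = 1 -> x = (theta + t) / 2.
Proof.
move=> thetat /(congr1 (fun y => y * (1 + (x - t) ^+ 2))).
rewrite /sqr_ratio divfK ?gt_eqF ?gt0_1Dsqr// mul1r => h.
have tt : t - theta != 0 by rewrite subr_eq0 eq_sym.
have h2 : (t - theta) * (2 * x) = (t - theta) * (theta + t).
  by have := h; rewrite !expr2; nra.
have := mulfI tt h2; lra.
Qed.

(** The numerators agree, so only [1 + (x - t)^2] and [1 + (x - u)^2] are compared. The factor does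
    not depend on [x] and tends to 1 with [e], so a mean below 1 stays below 1 for small [e]. *)
Lemma sqr_ratio_near (theta t u x e : R) : `|u - t| <= e ->
  sqr_ratio theta u x <= (1 + e + e ^+ 2) * sqr_ratio theta t x.
Proof.
move=> ute; have e0 : 0 <= e by exact: le_trans ute.
rewrite /sqr_ratio mulrCA ler_pM2l ?gt0_1Dsqr//.
rewrite ler_pdivlMr ?gt0_1Dsqr// ler_pdivrMl ?gt0_1Dsqr//.
move: ute; rewrite ler_norml => /andP[ue1 ue2].
set a := x - u; have -> : x - t = a + (u - t) by rewrite /a; ring.
set b := u - t in ue1 ue2 *.
have b2 : b ^+ 2 <= e ^+ 2.
  by rewrite -[b ^+ 2]real_normK ?num_real// lerXn2r ?nnegrE// ler_norml ue1.
(* Half the sum of [h3] and [h4] is [e (1 + a^2) - 2ab]. *)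
have ab : 2 * (a * b) <= e * (1 + a ^+ 2).
  have h1 : 0 <= (e - b) * (1 - a) ^+ 2 by rewrite mulr_ge0 ?sqr_ge0 ?subr_ge0.
  have h2 : 0 <= (e + b) * (1 + a) ^+ 2.
    by rewrite mulr_ge0 ?sqr_ge0// -lerBlDl sub0r.
  have h3 : 0 <= (e - b) * (1 + a) ^+ 2 by rewrite mulr_ge0 ?sqr_ge0 ?subr_ge0.
  have h4 : 0 <= (e + b) * (1 - a) ^+ 2.
    by rewrite mulr_ge0 ?sqr_ge0// -lerBlDl sub0r.
  nra.
have ea : 0 <= e ^+ 2 * a ^+ 2 by rewrite mulr_ge0 ?sqr_ge0.
nra.
Qed.

(* Peetre's inequality. *)
Lemma sqr_ratio_far (theta t x : R) :
  sqr_ratio theta t x <=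
  2 / (1 + (t - theta) ^+ 2) * (1 + (x - theta) ^+ 2) ^+ 2.
Proof.
rewrite /sqr_ratio ler_pdivrMr ?gt0_1Dsqr//.
rewrite [2 / _ * _]mulrAC [leRHS]mulrAC ler_pdivlMr ?gt0_1Dsqr//.
set y := x - theta; have -> : t - theta = y - (x - t) by rewrite /y; ring.
set z := x - t.
rewrite [leRHS](_ : _ = (1 + y ^+ 2) * (2 * (1 + y ^+ 2) * (1 + z ^+ 2))); last ring.
rewrite ler_pM2l ?gt0_1Dsqr//.
(* The right side exceeds the left by [1 + (y + z)^2 + 2 (yz)^2]. *)
have := sqr_ge0 (y + z); have := sqr_ge0 (y * z); nra.
Qed.

Lemma prodr_powR (I : Type) (s : seq I) (F : I -> R) (p : R) :
  (forall i, 0 <= F i) -> \prod_(i <- s) F i `^ p = (\prod_(i <- s) F i) `^ p.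
Proof.
move=> F0; elim: s => [|i s IH]; first by rewrite !big_nil powR1.
by rewrite !big_cons IH powRM//; apply: prodr_ge0.
Qed.

Lemma pvii_const_ge0 (m : R) : 0 <= pvii_const m.
Proof.
by rewrite invr_ge0; apply: Rintegral_ge0 => x _; exact: powR_ge0.
Qed.

Lemma pvii_f_ge0 (m x : R) : 0 <= pvii_f m x.
Proof. by rewrite mulr_ge0 ?pvii_const_ge0 ?powR_ge0. Qed.

Lemma measurable_powR_1Dsqr (p t : R) :
  measurable_fun setT (fun x : R => (1 + (x - t) ^+ 2) `^ p).
Proof. apply: continuous_measurable_fun; exact: continuous_powR_1Dsqr. Qed.

Lemma measurable_pvii_f (m t : R) :
  measurable_fun setT (fun x : R => pvii_f m (x - t)).
Proof. by apply: measurable_funM => //; exact: measurable_powR_1Dsqr. Qed.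

Lemma sqr_ratio_powR (theta t x p : R) :
  sqr_ratio theta t x `^ p =
  (1 + (x - theta) ^+ 2) `^ p * (1 + (x - t) ^+ 2) `^ (- p).
Proof.
have h := gt0_1Dsqr (x - t).
rewrite powRM ?invr_ge0; [|exact/ltW/gt0_1Dsqr|exact: ltW].
by rewrite -powR_inv1 ?ltW// -powRrM mulN1r.
Qed.

Lemma measurable_sqr_ratio_powR (theta t p : R) :
  measurable_fun setT (fun x : R => sqr_ratio theta t x `^ p).
Proof.
under eq_fun do rewrite sqr_ratio_powR.
by apply: measurable_funM; exact: measurable_powR_1Dsqr.
Qed.

Lemma pvii_f_sqr_ratio (m theta t x : R) :
  pvii_f m (x - theta) * sqr_ratio theta t x `^ m = pvii_f m (x - t).
Proof.
rewrite /pvii_f sqr_ratio_powR -mulrA; congr (_ * _).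
rewrite mulrA -powRD ?addNr ?powRr0 ?mul1r//.
by rewrite (gt_eqF (gt0_1Dsqr _)) implybT.
Qed.

(** * Expectations under the Pearson VII law *)

Section law.
Context (d : measure_display) (T : measurableType d) (P : probability T R)
  (m theta : R) (X : {RV P >-> R}).
Hypothesis hX : has_pvii_law P m theta X.

(** The law gives this for indicators; the transfer lemma, with weight 1 on one side and the density
    on the other, extends it to [h]. *)
Lemma integral_pvii (h : R -> R) : measurable_fun setT h ->
  (forall x, 0 <= h x) ->
  (\int[P]_w (h (X w))%:E = \int[mu]_x (pvii_f m (x - theta) * h x)%:E)%E.
Proof.
move=> mh h0.
under eq_integral do rewrite -[h _]mul1r.
apply: (@ge0_integral_transfer _ _ _ _ _ _ _ P mu X id (cst 1)) => //.
- exact: measurable_pvii_f.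
- by move=> x; exact: pvii_f_ge0.
move=> A mA; under eq_integral do rewrite mul1r.
transitivity (P (X @^-1` A)).
  rewrite (_ : (fun w => (\1_A (X w))%:E) = (fun w => (\1_(X @^-1` A) w)%:E))//.
  rewrite integral_indic ?setIT//.
  by rewrite -[X in measurable X]setTI; exact: (measurable_funP X).
rewrite hX// [LHS]integral_mkcond; apply: eq_integral => x _.
by rewrite patchE indicE; case: ifP; rewrite ?mulr1 ?mulr0.
Qed.

(** A zero constant would make the density vanish, whereas the law of [X] has mass 1. *)
Lemma pvii_law_const_gt0 : 0 < pvii_const m.
Proof.
rewrite lt_neqAle pvii_const_ge0 andbT; apply/eqP => c0.
have := hX measurableT; rewrite preimage_setT probability_setT.
rewrite integral0_eq => [|x _]; last by rewrite /pvii_f -c0 mul0r.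
by move/eqP; rewrite onee_eq0.
Qed.

(** The law of [X] has mass 1 at location [theta], and translation invariance carries this to every
    [t]. *)
Lemma integral_pvii_f (t : R) : (\int[mu]_x (pvii_f m (x - t))%:E = 1)%E.
Proof.
have := hX measurableT; rewrite preimage_setT probability_setT => ->.
have mf : measurable_fun setT (fun x : R => (pvii_f m x)%:E).
  apply/measurable_EFinP; have := measurable_pvii_f m 0.
  by under eq_fun do rewrite subr0.
rewrite (@ge0_integral_shift _ t (fun x => (pvii_f m x)%:E))//.
  by rewrite (@ge0_integral_shift _ theta (fun x => (pvii_f m x)%:E))// => x;
    rewrite lee_fin pvii_f_ge0.
by move=> x; rewrite lee_fin pvii_f_ge0.
Qed.

(** Multiplied by the density, the integrand becomes a translate of a multiple of
    [(1 + x^2)^(-(m - p))], integrable since [m - p > 1/2]. *)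
Lemma integral_pvii_moment_lty (p : R) : p < m - 1 / 2 ->
  (\int[P]_w ((1 + (X w - theta) ^+ 2) `^ p)%:E < +oo)%E.
Proof.
move=> pm.
rewrite (integral_pvii (measurable_powR_1Dsqr p theta)); last first.
  by move=> x; exact: powR_ge0.
pose g (x : R) := ((1 + x ^+ 2) `^ (- (m - p)))%:E.
have mg : measurable_fun setT g.
  apply/measurable_EFinP; have := measurable_powR_1Dsqr (- (m - p)) 0.
  by under eq_fun do rewrite subr0.
have -> : (\int[mu]_x (pvii_f m (x - theta) * (1 + (x - theta) ^+ 2) `^ p)%:E =
    \int[mu]_x ((pvii_const m)%:E * g (x - theta)%R))%E.
  apply: eq_integral => x _; rewrite -EFinM /pvii_f -mulrA -powRD.
    by rewrite (_ : - m + p = - (m - p))//; ring.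
  by rewrite (gt_eqF (gt0_1Dsqr _)) implybT.
have g0 x : (0 <= g x)%E by rewrite lee_fin powR_ge0.
rewrite ge0_integralZl_EFin//; last 2 first.
- apply: (measurableT_comp mg); exact: measurable_funB.
- exact: pvii_const_ge0.
rewrite ge0_integral_shift//; apply: lte_mul_pinfty => //.
  by rewrite lee_fin pvii_const_ge0.
by apply: integral_powR_1Dsqr_lty; lra.
Qed.

(* The integral is the Hellinger affinity of the laws with parameters [theta]
   and [t]; it is below [1] by integrating [0 <= (1 - rho)^2], which vanishes
   only at the midpoint of [theta] and [t]. *)
Lemma integral_pvii_affinity_lt1 (t : R) : 0 < m -> theta != t ->
  (\int[P]_w (sqr_ratio theta t (X w) `^ (m / 2))%:E < 1)%E.
Proof.
move=> m0 thetat.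
pose rho x := sqr_ratio theta t x `^ (m / 2).
have mrho : measurable_fun setT rho by exact: measurable_sqr_ratio_powR.
have rho0 x : 0 <= rho x by exact: powR_ge0.
have mrhoX : measurable_fun setT (rho \o X) by exact: measurableT_comp.
have rho2 x : rho x ^+ 2 = sqr_ratio theta t x `^ m.
  by rewrite -powR_mulrn// -powRrM divfK// pnatr_eq0.
(* Weighting the density at [theta] by [rho^2] gives the density at [t], of mass 1. *)
have E2 : (\int[P]_w (rho (X w) ^+ 2)%:E = 1)%E.
  rewrite (@integral_pvii (fun x => rho x ^+ 2))//.
  - rewrite -(integral_pvii_f t); apply: eq_integral => x _.
    by rewrite rho2 pvii_f_sqr_ratio.
  - exact: measurable_funX.
  - by move=> x; rewrite exprn_ge0.
(* The expansion of [(1 - rho)^2], kept free of subtraction because finiteness of the mean of [rho]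
   is not yet known. *)
have Eeq : (\int[P]_w (2 * rho (X w))%:E + \int[P]_w ((1 - rho (X w)) ^+ 2)%:E
    = 2%:E)%E.
  rewrite -ge0_integralD//.
  - rewrite (eq_integral (fun w => 1%:E + (rho (X w) ^+ 2)%:E)%E); last first.
      by move=> w _; rewrite -!EFinD; congr EFin; ring.
    rewrite ge0_integralD//.
    + by rewrite integral_cst// E2 /= probability_setT mule1 -EFinD.
    + by move=> w _; rewrite lee_fin exprn_ge0.
    + exact/measurable_EFinP/measurable_funX.
  - by move=> w _; rewrite lee_fin mulr_ge0.
  - by apply/measurable_EFinP; apply: measurable_funM.
  - by move=> w _; rewrite lee_fin sqr_ge0.
  - by apply/measurable_EFinP; apply: measurable_funX; apply: measurable_funB.
rewrite ltNge; apply/negP => E1.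
have E0 : (\int[P]_w `|((1 - rho (X w)) ^+ 2)%:E| = 0)%E.
  under eq_integral do rewrite gee0_abs ?lee_fin ?sqr_ge0//.
  have E2r : (\int[P]_w (2 * rho (X w))%:E = 2%:E * \int[P]_w (rho (X w))%:E)%E.
    rewrite -ge0_integralZl_EFin//; last exact/measurable_EFinP.
    by move=> w _; rewrite lee_fin.
  move: Eeq; rewrite E2r.
  have : (0 <= \int[P]_w ((1 - rho (X w)) ^+ 2)%:E)%E.
    by apply: integral_ge0 => w _; rewrite lee_fin sqr_ge0.
  move: E1; rewrite -/(rho _).
  move: (integral _ _ _) (integral _ _ _) => [a| |] [b| |]//=.
  - by rewrite !lee_fin -EFinM -EFinD => a1 b0 [] ab; congr EFin; lra.
  - by rewrite gt0_muley ?lte_fin.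
  - by rewrite gt0_muley ?lte_fin.
have m1rho : measurable_fun setT (fun w => ((1 - rho (X w)) ^+ 2)%:E).
  by apply/measurable_EFinP; apply: measurable_funX; apply: measurable_funB.
have [N [mN PN0 sub]] := (ae_eq_integral_abs P measurableT m1rho).1 E0.
pose mid := (theta + t) / 2.
have mM : measurable (X @^-1` [set mid]).
  by rewrite -[X in measurable X]setTI; exact: (measurable_funP X).
have PM0 : P (X @^-1` [set mid]) = 0%E by rewrite hX// integral_set1.
(* Now [rho (X w) = 1] almost surely, so [X] is almost surely the midpoint; but a law with a density
   does not charge a point. *)
have : P setT = 0%E.
  apply: (@measure_negligible _ _ _ P) => //.
  apply: (@negligibleS _ _ _ P (N `|` X @^-1` [set mid])); last first.
    by apply: negligibleU; exact/negligibleP.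
  move=> w _; case: (pselect (X w = mid)) => Xw; [by right|left].
  apply: sub => /= /(_ I) [] /eqP; rewrite sqrf_eq0 subr_eq0 => /eqP r1.
  apply: Xw; apply: sqr_ratio_eq1 => //.
  have : 1 `^ (m / 2) = sqr_ratio theta t (X w) `^ (m / 2) by rewrite powR1.
  move/powR_injective => <-//; rewrite ?nnegrE ?ltW ?sqr_ratio_gt0//.
  by rewrite divr_gt0.
by rewrite probability_setT => /eqP; rewrite onee_eq0.
Qed.

End law.
End pvii.

(** The likelihood at [t] is the positive likelihood at [theta] times the [m]-th power of the
    product of ratios. That product is thus at least 1, and so is each of its positive powers. *)
Lemma pvii_likelihood_ratio_ge1 (R : realType) (m theta t s : R) (n : nat)
    (x : n.-tuple R) : 0 < pvii_const m -> 0 < m -> 0 < s ->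
  pvii_likelihood m x theta <= pvii_likelihood m x t ->
  1 <= \prod_(i < n) sqr_ratio theta t (tnth x i) `^ s.
Proof.
move=> c0 m0 s0 lik.
have r0 i : 0 <= sqr_ratio theta t (tnth x i) by rewrite ltW// sqr_ratio_gt0.
have p0 : 0 <= \prod_(i < n) sqr_ratio theta t (tnth x i) by exact: prodr_ge0.
have {lik} : 1 <= (\prod_(i < n) sqr_ratio theta t (tnth x i)) `^ m.
  have L0 : 0 < pvii_likelihood m x theta.
    by apply: prodr_gt0 => i _; rewrite mulr_gt0// powR_gt0// gt0_1Dsqr.
  rewrite -(ler_pM2l L0) mulr1 (le_trans lik)// -prodr_powR// -big_split/=.
  by under [leRHS]eq_bigr do rewrite pvii_f_sqr_ratio.
rewrite prodr_powR//; set p := \prod_(i < n) _ in p0 *.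
have [p1 _|p1] := leP 1 p.
  have -> : 1 = 1 `^ s :> R by rewrite powR1.
  by rewrite ge0_ler_powR// ?nnegrE// ltW.
have : p `^ m < 1 `^ m by rewrite gt0_ltr_powR ?nnegrE.
by rewrite powR1 => /lt_le_trans h /h; rewrite ltxx.
Qed.

(** * Almost sure eventual properties as a filter *)

Section ae_eventually.
Context (R : realType) (d : measure_display) (T : measurableType d)
  (P : probability T R).

(* As a filter, this lets [near_covering] handle neighbourhoods whose null sets
   and ranks depend on the centre. *)
Definition ae_eventually : set_system (T * nat) :=
  [set A | {ae P, forall w, \forall n \near \oo, A (w, n)}].

Global Instance ae_eventually_filter : Filter ae_eventually.
Proof.
split.
- by apply: aeW => w; exact: nearW.
- move=> A B; rewrite /ae_eventually/=; apply: filterS2 => w.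
  exact: filterI.
- move=> A B AB; rewrite /ae_eventually/=; apply: filterS => w.
  by apply: filterS => n; exact: AB.
Qed.

End ae_eventually.

(** * Localising the estimator *)

Section consistency.
Context (R : realType) (d : measure_display) (T : measurableType d)
  (P : probability T R) (m : R) (X : nat -> {RV P >-> R})
  (thetahat : forall n : nat, n.-tuple R -> R) (theta : R).
Hypothesis hm : 1 / 2 < m.
Hypothesis hmax : forall (n : nat) (x : n.-tuple R) (t : R),
  pvii_likelihood m x t <= pvii_likelihood m x (thetahat x).
Hypothesis hX : forall n, has_pvii_law P m theta (X n).
Hypothesis indep : mutually_independent P (fun n => (X n : T -> R)).

(** Outcome and sample size are paired so that events about the estimator are subsets of [T * nat],
    as [ae_eventually] expects. *)
Let mle (p : T * nat) : R := thetahat [tuple X i p.1 | i < p.2].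

Let m_gt0 : 0 < m. Proof. by apply: lt_trans hm; rewrite divr_gt0. Qed.

(** Whenever the estimator lies in [U], the product of the [G (X i)] dominates a product of ratio
    powers that is at least 1; almost surely this eventually stops. *)
Let ae_eventually_mle_notin (U : set R) (G : R -> R) (s : R) : 0 < s ->
  measurable_fun setT G -> (forall x, 0 <= G x) ->
  (forall t x, U t -> sqr_ratio theta t x `^ s <= G x) ->
  (\int[P]_w (G (X 0%N w))%:E < 1)%E ->
  ae_eventually P [set p | ~ U (mle p)].
Proof.
move=> s0 mG G0 UG EG.
have ident n (A : set R) : measurable A ->
    P (X n @^-1` A) = P (X 0%N @^-1` A) by move=> mA; rewrite !hX.
have := ae_near_prod_lt1 indep ident mG G0 EG.
apply: filterS => w; apply: filterS => n /= prodlt1 Uw.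
move: prodlt1; apply/negP; rewrite -leNgt.
have := pvii_likelihood_ratio_ge1 (pvii_law_const_gt0 (hX 0%N)) m_gt0 s0
  (hmax [tuple X i w | i < n] theta).
move=> /le_trans; apply; apply: ler_prod => i _.
by rewrite powR_ge0/= tnth_mktuple; exact: UG.
Qed.

Let ae_eventually_mle_bounded :
  exists K, ae_eventually P [set p | `|mle p - theta| <= K].
Proof.
(* The bound at infinity involves [(1 + (x - theta)^2)^2], whose [s]-th power has finite mean since
   [2s < m - 1/2]. *)
have m12 := hm; pose s := (m - 1 / 2) / 4; have s0 : 0 < s by rewrite /s; lra.
pose h x := (1 + (x - theta) ^+ 2) `^ (2 * s).
have mh : measurable_fun setT h by exact: measurable_powR_1Dsqr.
have h0 x : 0 <= h x by exact: powR_ge0.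
have I0 : (0 <= \int[P]_w (h (X 0%N w))%:E)%E.
  by apply: integral_ge0 => w _; rewrite lee_fin.
have Ifin : (\int[P]_w (h (X 0%N w))%:E)%E \is a fin_num.
  rewrite ge0_fin_numE//; apply: integral_pvii_moment_lty => //.
  by rewrite /s; lra.
pose M := fine (\int[P]_w (h (X 0%N w))%:E)%E.
have M0 : 0 <= M by rewrite fine_ge0.
(* [A] is chosen so that [A^(-s) = 1 / (M + 1)], and [K] so that [a <= 1 / A]; hence
   [a^s M <= M / (M + 1) < 1]. *)
pose A := (M + 1) `^ s^-1; have A0 : 0 < A by rewrite powR_gt0// ltr_wpDl.
pose K := 1 + 2 * A; pose a := 2 / (1 + K ^+ 2).
have a0 : 0 <= a by rewrite divr_ge0// ltW// gt0_1Dsqr.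
have aA : a <= A^-1.
  rewrite /a ler_pdivrMr ?gt0_1Dsqr// ler_pdivlMl// /K.
  have := mulr_gt0 A0 A0; rewrite expr2; nra.
have aM : a `^ s * M < 1.
  apply: (@le_lt_trans _ _ ((M + 1)^-1 * M)).
    apply: ler_wpM2r => //.
    have -> : (M + 1)^-1 = (A^-1) `^ s.
      rewrite -[A^-1]powR_inv1 ?(ltW A0)// -powRrM mulN1r powRN /A.
      by rewrite -powRrM mulVf ?gt_eqF// powRr1// addr_ge0.
    by rewrite ge0_ler_powR ?nnegrE// ?invr_ge0 ltW.
  by rewrite ltr_pdivrMl ?ltr_wpDl// mulr1 ltrDl.
exists K.
have := @ae_eventually_mle_notin [set t | K < `|t - theta|]
  (fun x => a `^ s * h x) s s0.
have K0 : 0 <= K by rewrite /K; lra.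
suff H : [/\ measurable_fun setT (fun x => a `^ s * h x),
    forall x, 0 <= a `^ s * h x,
    forall t x, K < `|t - theta| -> sqr_ratio theta t x `^ s <= a `^ s * h x &
    (\int[P]_w (a `^ s * h (X 0%N w))%:E < 1)%E].
  case: H => H1 H2 H3 H4 => /(_ H1 H2 H3 H4).
  by apply: filterS => p /= /negP; rewrite -leNgt.
split.
- exact: measurable_funM.
- by move=> x; rewrite mulr_ge0 ?powR_ge0.
- move=> t x Kt; have r0 := ltW (sqr_ratio_gt0 theta t x).
  have Y0 := gt0_1Dsqr (x - theta).
  have -> : h x = ((1 + (x - theta) ^+ 2) ^+ 2) `^ s.
    by rewrite /h powRrM powR_mulrn// ltW.
  rewrite -powRM ?exprn_ge0// ?(ltW Y0)//.
  apply: (ge0_ler_powR (ltW s0)); rewrite ?nnegrE//.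
    exact: mulr_ge0 a0 (exprn_ge0 _ (ltW Y0)).
  apply: le_trans (sqr_ratio_far _ _ _) _.
  rewrite ler_wpM2r ?exprn_ge0 ?(ltW Y0)// /a ler_pM2l//.
  rewrite lef_pV2 ?posrE ?gt0_1Dsqr// lerD2l -[leRHS]real_normK ?num_real//.
  by rewrite lerXn2r ?nnegrE// ltW.
- under eq_integral do rewrite EFinM.
  rewrite ge0_integralZl_EFin ?powR_ge0//.
  + by rewrite -(fineK Ifin) -EFinM lte_fin.
  + by move=> w _; rewrite lee_fin.
  + by apply/measurable_EFinP; exact: measurableT_comp.
Qed.

Let ae_eventually_mle_notin_nbhs (t : R) : theta != t ->
  exists2 e, 0 < e & ae_eventually P [set p | ~ `|mle p - t| <= e].
Proof.
move=> thetat.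
have m20 : 0 < m / 2 by rewrite divr_gt0.
pose h x := sqr_ratio theta t x `^ (m / 2).
have mh : measurable_fun setT h by exact: measurable_sqr_ratio_powR.
have h0 x : 0 <= h x by exact: powR_ge0.
have I1 : (\int[P]_w (h (X 0%N w))%:E < 1)%E.
  exact: integral_pvii_affinity_lt1.
have I0 : (0 <= \int[P]_w (h (X 0%N w))%:E)%E.
  by apply: integral_ge0 => w _; rewrite lee_fin.
have Ifin : (\int[P]_w (h (X 0%N w))%:E)%E \is a fin_num.
  by rewrite ge0_fin_numE// (lt_trans I1)// ltry.
pose M := fine (\int[P]_w (h (X 0%N w))%:E)%E.
have M0 : 0 <= M by rewrite fine_ge0.
have M1 : M < 1 by rewrite -lte_fin fineK.
(* Any factor up to [c > 1] keeps the mean below 1, as [c M = 2M / (1 + M) < 1]. *)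
pose c := 2 / (1 + M).
have c1 : 1 < c by rewrite ltr_pdivlMr; lra.
have cM : c * M < 1 by rewrite mulrAC ltr_pdivrMr; lra.
pose q := c `^ (m / 2)^-1.
have q1 : 1 < q.
  have -> : 1 = 1 `^ (m / 2)^-1 :> R by rewrite powR1.
  rewrite gt0_ltr_powR ?invr_gt0// ?nnegrE//; lra.
(* Since [e <= 1], [1 + e + e^2 <= 1 + 2e <= q], and [q^(m/2) = c]. *)
pose e := Num.min 1 ((q - 1) / 2).
have e0 : 0 < e by rewrite lt_min ltr01/=; lra.
have e1 : e <= 1 by rewrite ge_min lexx.
have eq : e <= (q - 1) / 2 by rewrite ge_min lexx orbT.
exists e => //.
pose b := 1 + e + e ^+ 2.
have b0 : 0 <= b by rewrite /b !addr_ge0// ?sqr_ge0// ltW.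
have bc : b `^ (m / 2) <= c.
  have -> : c = q `^ (m / 2).
    by rewrite /q -powRrM mulVf ?gt_eqF// powRr1//; lra.
  rewrite ge0_ler_powR ?nnegrE ?(ltW m20)//; first lra.
  rewrite /b expr2; nra.
apply: (@ae_eventually_mle_notin [set u | `|u - t| <= e]
  (fun x => b `^ (m / 2) * h x) (m / 2)) => //.
- exact: measurable_funM.
- by move=> x; rewrite mulr_ge0 ?powR_ge0.
- move=> u x /= ut; have r0 v := ltW (sqr_ratio_gt0 theta v x).
  rewrite /h -powRM//; apply: (ge0_ler_powR (ltW m20)); rewrite ?nnegrE//.
    exact: mulr_ge0.
  exact: sqr_ratio_near.
- under eq_integral do rewrite EFinM.
  rewrite ge0_integralZl_EFin ?powR_ge0//.
  + rewrite -(fineK Ifin) -EFinM lte_fin (le_lt_trans _ cM)//.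
    exact: ler_wpM2r.
  + by move=> w _; rewrite lee_fin.
  + by apply/measurable_EFinP; exact: measurableT_comp.
Qed.

Lemma ae_eventually_mle_near (e : R) : 0 < e ->
  ae_eventually P [set p | `|mle p - theta| < e].
Proof.
move=> e0; have [K FK] := ae_eventually_mle_bounded.
have /compact_near_coveringP := @segment_compact R (theta - K) (theta + K).
(* The property concerns a free point [t] of the segment. Once it holds uniformly in [t], taking [t]
   to be [mle p] itself refutes the first alternative. *)
move=> /(_ _ (ae_eventually P) (fun p t => mle p <> t \/ `|t - theta| < e) _).
have cover t : [set` `[theta - K, theta + K]] t ->
    \forall t' \near t & p \near ae_eventually P,
      mle p <> t' \/ `|t' - theta| < e.
  move=> _; have [<-|thetat] := eqVneq theta t.
    exists ([set u | `|u - theta| < e], setT).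
      split => /=; last exact: filterT.
      by apply/nbhs_ballP; exists e => //= u; rewrite /ball/= distrC.
    by move=> [u p] [/= ue _]; right.
  have [b b0 Fb] := ae_eventually_mle_notin_nbhs thetat.
  exists ([set u | `|u - t| <= b], [set p | ~ `|mle p - t| <= b]).
    split => //=; apply/nbhs_ballP; exists b => //= u.
    by rewrite /ball/= distrC => /ltW.
  by move=> [u p] [/= ub pb]; left => pu; apply: pb; rewrite pu.
move=> /(_ cover); apply: filterS2 FK => p /= pK /(_ (mle p)).
rewrite /= in_itv/= -ler_distlC distrC pK => /(_ isT).
by case.
Qed.

End consistency.

Theorem theorem1p1 (R : realType) (d : measure_display) (T : measurableType d)
  (P : probability T R) (m : R) (hm : 1 / 2 < m)
  (X : nat -> {RV P >-> R})
  (thetahat : forall n : nat, n.-tuple R -> R)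
  (hmeas : forall n : nat, measurable_fun setT (thetahat n))
  (hmax : forall (n : nat) (x : n.-tuple R) (t : R),
     pvii_likelihood m x t <= pvii_likelihood m x (thetahat n x)) :
  forall theta : R,
    (forall n, has_pvii_law P m theta (X n)) ->
    mutually_independent P (fun n => (X n : T -> R)) ->
    {ae P, forall w, thetahat n [tuple X i w | i < n] @[n --> \oo] --> theta}.
Proof.
move=> theta hX indep.
(* Countably many radii suffice, so the exceptional null sets can be united. *)
have /ae_foralln : forall k : nat, {ae P, forall w, \forall n \near \oo,
    `|thetahat n [tuple X i w | i < n] - theta| < k.+1%:R^-1}.
  by move=> k; apply: (ae_eventually_mle_near hm hmax hX indep); rewrite invr_gt0.
apply: filterS => w h; apply/cvgrPdist_lt => e e0.
have [k _ /(_ _ (leqnn k)) ke] := near_infty_natSinv_lt (PosNum e0).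
by near do rewrite distrC (lt_trans _ ke)//; exact: h.
Unshelve. all: by end_near. Qed.
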